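(* Let $\mathcal{Q}$ be a seminormal quasi-crystal with underlying set $Q$, and let $u,v\in Q^*$ be such that $uv$ is an isolated element of $\mathcal{Q}^{*}$. Then $uvw\ \ddot{\sim}\ uwv\ \ddot{\sim}\ wuv$ for every $w\in Q^*$.
   Context: Root system data: $V$ a finite-dimensional real inner product space, $\alpha^\vee=\frac{2}{\langle\alpha,\alpha\rangle}\alpha$; a root system $\Phi$ with fixed simple roots $(\alpha_i)_{i\in I}$ and weight lattice $\Lambda$ (a $\mathbb{Z}$-submodule of $V$ spanning $V$, containing $\Phi$, with $\langle\lambda,\alpha^\vee\rangle\in\mathbb{Z}$ for $\alpha\in\Phi$). A quasi-crystal of type $\Phi$ is a set $Q$ with maps $\mathrm{wt}:Q\to\Lambda$, $\ddot{e}_i,\ddot{f}_i:Q\to Q\sqcup\{\bot\}$ ($\bot$ = undefined), $\ddot{\varepsilon}_i,\ddot{\varphi}_i:Q\to\mathbb{Z}\cup\{\pm\infty\}$ ($i\in I$) such that: $\ddot{\varphi}_i(x)=\ddot{\varepsilon}_i(x)+\langle\mathrm{wt}(x),\alpha_i^\vee\rangle$ (with $m+(\pm\infty)=\pm\infty$); if $\ddot{e}_i(x)\in Q$ then $\mathrm{wt}(\ddot{e}_i(x))=\mathrm{wt}(x)+\alpha_i$, $\ddot{\varepsilon}_i(\ddot{e}_i(x))=\ddot{\varepsilon}_i(x)-1$, $\ddot{\varphi}_i(\ddot{e}_i(x))=\ddot{\varphi}_i(x)+1$; if $\ddot{f}_i(x)\in Q$ then $\mathrm{wt}(\ddot{f}_i(x))=\mathrm{wt}(x)-\alpha_i$,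 $\ddot{\varepsilon}_i(\ddot{f}_i(x))=\ddot{\varepsilon}_i(x)+1$, $\ddot{\varphi}_i(\ddot{f}_i(x))=\ddot{\varphi}_i(x)-1$; $\ddot{e}_i(x)=y\iff x=\ddot{f}_i(y)$; $\ddot{\varepsilon}_i(x)=\pm\infty$ implies $\ddot{e}_i(x)=\ddot{f}_i(x)=\bot$. Seminormal: whenever $\ddot{\varepsilon}_i(x)\ne+\infty$, $\ddot{\varepsilon}_i(x)=\max\{k\ge0:\ddot{e}_i^k(x)\in Q\}$ and $\ddot{\varphi}_i(x)=\max\{k\ge0:\ddot{f}_i^k(x)\in Q\}$. A quasi-crystal isomorphism between quasi-crystals with underlying sets $X,Y$ is a bijection $\psi:X\to Y$ preserving $\mathrm{wt},\ddot{\varepsilon}_i,\ddot{\varphi}_i$ such that $\ddot{e}_i(\psi(x))$ is defined iff $\ddot{e}_i(x)$ is, and then $\psi(\ddot{e}_i(x))=\ddot{e}_i(\psi(x))$; likewise for $\ddot{f}_i$. The free quasi-crystal monoid $\mathcal{Q}^{*}$: words over $Q$ with: for the empty word, $\mathrm{wt}=0$, $\ddot{\varepsilon}_i=\ddot{\varphi}_i=0$, $\ddot{e}_i,\ddot{f}_i$ undefined; for $w=x_1\cdots x_m$ ($m\ge1$), $\mathrm{wt}(w)=\sum_k\mathrm{wt}(x_k)$, and with $p=\max\{k:\ddot{\varepsilon}_i(x_k)>0\}$, $q=\min\{l:\ddot{\varphi}_i(x_l)>0\}$: if some $\ddot{\varepsilon}_i(x_k)=+\infty$, or $p,q$ exist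 with $p>q$, then $\ddot{\varepsilon}_i(w)=\ddot{\varphi}_i(w)=+\infty$ and $\ddot{e}_i,\ddot{f}_i$ undefined on $w$; otherwise $\ddot{\varepsilon}_i(w)=\sum_k\ddot{\varepsilon}_i(x_k)$, $\ddot{\varphi}_i(w)=\sum_k\ddot{\varphi}_i(x_k)$, $\ddot{e}_i(w)$ is defined iff $p$ exists and is then $w$ with $x_p$ replaced by $\ddot{e}_i(x_p)$, and $\ddot{f}_i(w)$ is defined iff $q$ exists and is then $w$ with $x_q$ replaced by $\ddot{f}_i(x_q)$. The connected component $Q^*(w)$ is the set of words obtained from $w$ by finitely many (defined) applications of operators $\ddot{e}_i,\ddot{f}_i$, with restricted structure. An element $w$ is isolated if $Q^*(w)=\{w\}$. Hypoplactic congruence: $u\ddot{\sim}v$ iff there is a quasi-crystal isomorphism $Q^*(u)\to Q^*(v)$ sending $u$ to $v$. *)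

(* Defs.v *)
From HB Require Import structures.
From mathcomp Require Import all_boot all_order all_algebra.
From mathcomp Require Import sesquilinear.
From mathcomp Require Import boolp classical_sets cardinality reals.
From mathcomp Require Import constructive_ereal.

Set Implicit Arguments.
Unset Strict Implicit.
Unset Printing Implicit Defensive.

Import Order.TTheory GRing.Theory Num.Theory.
Local Open Scope classical_set_scope.
Local Open Scope ring_scope.

Section RootData.
Variables (R : realType) (V : vectType R) (dot : {dot V for idfun}).

Definition coroot (a : V) : V := (2 / dot a a) *: a.

(* Phi is not required to span V (the weight lattice is), so that the
   gl_n-style root systems in R^n are covered. *)
Record is_root_system (Phi : set V) : Prop := IsRootSystem {
  root_finite : finite_set Phi;
  root_neq0 : forall a, Phi a -> a != 0;
  root_reduced : forall a c, Phi a -> Phi (c *: a) -> c = 1 \/ c = -1;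
  root_reflection :
    forall a b, Phi a -> Phi b -> Phi (b - dot b (coroot a) *: a);
  root_integral :
    forall a b, Phi a -> Phi b -> dot b (coroot a) \is a Num.int
}.

Record is_simple_system (Phi : set V) (I : finType) (alpha : I -> V) : Prop :=
  IsSimpleSystem {
  simple_root : forall i, Phi (alpha i);
  simple_free : free [seq alpha i | i : I];
  simple_decomposition : forall b, Phi b -> exists c : I -> nat,
    b = \sum_i alpha i *+ c i \/ b = - \sum_i alpha i *+ c i
}.

Record is_weight_lattice (Phi Lambda : set V) : Prop := IsWeightLattice {
  weight_zero : Lambda 0;
  weight_sub : forall l m, Lambda l -> Lambda m -> Lambda (l - m);
  weight_span : exists s : seq V,
    (forall l, l \in s -> Lambda l) /\ <<s>>%VS = fullv;
  weight_root : Phi `<=` Lambda;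
  weight_integral :
    forall l a, Lambda l -> Phi a -> dot l (coroot a) \is a Num.int
}.

End RootData.

(* The raw data of a quasi-crystal, separated from its axioms
   (is_quasi_crystal).  The undefined value is None, the set
   Z u {-oo, +oo} is \bar int, and weights are given as vectors of V. *)
Record qc_data (V I : Type) := QCData {
  qc_car :> Type;
  wt : qc_car -> V;
  qe : I -> qc_car -> option qc_car;
  qf : I -> qc_car -> option qc_car;
  qeps : I -> qc_car -> \bar int;
  qphi : I -> qc_car -> \bar int
}.

Section QuasiCrystal.
Variables (R : realType) (V : vectType R) (dot : {dot V for idfun}).
Variables (I : finType) (alpha : I -> V) (Lambda : set V).

(* The floor is exact: it is only used on weights, for which
   dot (wt x) (coroot (alpha i)) is an integer. *)
Definition wt_pairing (l : V) (i : I) : int :=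
  Num.floor (dot l (coroot dot (alpha i))).

Local Open Scope ereal_scope.

Record is_quasi_crystal (Q : qc_data V I) : Prop := IsQuasiCrystal {
  qc_wt : forall x : Q, Lambda (wt x);
  qc_phi : forall i (x : Q),
    qphi i x = qeps i x + (wt_pairing (wt x) i)%:E;
  qc_e : forall i (x y : Q), qe i x = Some y ->
    [/\ wt y = (wt x + alpha i)%R,
        qeps i y = qeps i x - 1 &
        qphi i y = qphi i x + 1];
  qc_f : forall i (x y : Q), qf i x = Some y ->
    [/\ wt y = (wt x - alpha i)%R,
        qeps i y = qeps i x + 1 &
        qphi i y = qphi i x - 1];
  qc_ef : forall i (x y : Q), qe i x = Some y <-> qf i y = Some x;
  qc_infinite : forall i (x : Q), qeps i x = -oo \/ qeps i x = +oo ->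
    qe i x = None /\ qf i x = None
}.

Definition is_max (P : nat -> Prop) (z : \bar int) : Prop :=
  exists n : nat,
    [/\ z = (n%:Z)%:E, P n & forall k, P k -> (k <= n)%N].

Definition seminormal (Q : qc_data V I) : Prop :=
  forall i (x : Q), qeps i x <> +oo ->
    is_max (fun k => isSome (iter k (obind (qe i)) (Some x))) (qeps i x) /\
    is_max (fun k => isSome (iter k (obind (qf i)) (Some x))) (qphi i x).

End QuasiCrystal.

Section Isomorphism.
Variables (V I : Type).

Record qc_iso (X Y : qc_data V I) (psi : X -> Y) : Prop := QCIso {
  iso_bij : bijective psi;
  iso_wt : forall x, wt (psi x) = wt x;
  iso_eps : forall i x, qeps i (psi x) = qeps i x;
  iso_phi : forall i x, qphi i (psi x) = qphi i x;
  iso_e_def : forall i x, isSome (qe i (psi x)) <-> isSome (qe i x);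
  iso_e : forall i x y, qe i x = Some y -> qe i (psi x) = Some (psi y);
  iso_f_def : forall i x, isSome (qf i (psi x)) <-> isSome (qf i x);
  iso_f : forall i x y, qf i x = Some y -> qf i (psi x) = Some (psi y)
}.

Definition qc_restrict (X : qc_data V I) (A : set X) : qc_data V I :=
  QCData
    (fun x : A => wt (val x))
    (fun i (x : A) => obind insub (qe i (val x)))
    (fun i (x : A) => obind insub (qf i (val x)))
    (fun i (x : A) => qeps i (val x))
    (fun i (x : A) => qphi i (val x)).

Inductive reachable (X : qc_data V I) (x : X) : X -> Prop :=
| reachable_refl : reachable x x
| reachable_e i y z : reachable x y -> qe i y = Some z -> reachable x z
| reachable_f i y z : reachable x y -> qf i y = Some z -> reachable x z.

Definition component (X : qc_data V I) (x : X) : set X :=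
  [set y | reachable x y].

Definition component_qc (X : qc_data V I) (x : X) : qc_data V I :=
  qc_restrict (component x).

Definition component_base (X : qc_data V I) (x : X) : component_qc x :=
  exist _ x (mem_set (reachable_refl x)).

Definition isolated (X : qc_data V I) (x : X) : Prop :=
  component x = [set x].

(* The relation is defined over an arbitrary quasi-crystal; applied to
   free_qc Q below, it is the hypoplactic congruence. *)
Definition component_equiv (X : qc_data V I) (x y : X) : Prop :=
  exists psi : component_qc x -> component_qc y,
    qc_iso psi /\ psi (component_base x) = component_base y.

End Isomorphism.

Section FreeMonoid.
Variables (V : nmodType) (I : Type) (Q : qc_data V I).
Implicit Types (i : I) (w : seq Q).

(* Replaces the letter of 0-based position k by its image under g. *)
Definition apply_at (g : Q -> option Q) (k : nat) w : option (seq Q) :=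
  if drop k w is x :: t then omap (fun y => take k w ++ y :: t) (g x)
  else None.

Local Open Scope ereal_scope.

Definition eps_pos i (x : Q) : bool := 0 < qeps i x.
Definition phi_pos i (x : Q) : bool := 0 < qphi i x.

(* The 0-based positions p and q; they exist only under
   has (eps_pos i) w and has (phi_pos i) w respectively. *)
Definition eps_last i w : nat :=
  (\max_(k < size w | eps_pos i (tnth (in_tuple w) k)) k)%N.
Definition phi_first i w : nat := find (phi_pos i) w.

Definition degenerate i w : bool :=
  has (fun x => qeps i x == +oo) w ||
  [&& has (eps_pos i) w, has (phi_pos i) w & (phi_first i w < eps_last i w)%N].

(* The empty word needs no separate clause: it is not degenerate, it has
   neither p nor q, and the sums below are empty. *)
Definition free_qc : qc_data V I := {|
  qc_car := seq Q;
  wt := fun w => (\sum_(x <- w) wt x)%R;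
  qe := fun i w =>
    if ~~ degenerate i w && has (eps_pos i) w
    then apply_at (qe i) (eps_last i w) w else None;
  qf := fun i w =>
    if ~~ degenerate i w && has (phi_pos i) w
    then apply_at (qf i) (phi_first i w) w else None;
  qeps := fun i w =>
    if degenerate i w then +oo else \sum_(x <- w) qeps i x;
  qphi := fun i w =>
    if degenerate i w then +oo else \sum_(x <- w) qphi i x
|}.

Definition hypoplactic (u v : seq Q) : Prop :=
  @component_equiv V I free_qc u v.

End FreeMonoid.

(* Main.v *)
(** Fix [i].  Seminormality and isolation of [uv] leave two cases: either [uv]
    is [i]-degenerate, and then so is every word having [uv] as a subword, or
    every letter of [uv] has [eps_i = phi_i = 0], and then the letters of [uv]
    are invisible to the [i]-structure.  In both cases the [i]-structure of a
    word obtained by inserting [w] into [uv] depends on [w] only and not on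
    the place of insertion, so moving the inserted word identifies the
    connected components. *)
Require Import Defs.
From mathcomp Require Import all_boot all_order all_algebra.
From mathcomp Require Import sesquilinear.
From mathcomp Require Import boolp classical_sets reals.
From mathcomp Require Import constructive_ereal.

Set Implicit Arguments.
Unset Strict Implicit.
Unset Printing Implicit Defensive.

Import Order.TTheory GRing.Theory Num.Theory.

Local Open Scope ring_scope.

(** * Isomorphisms between components with a common parametrization *)

Section Components.
Variables (V I : Type) (X : qc_data V I).

(** A component is closed under the operators, so the [insub] in [qc_restrict] never discards a
    defined value. *)
Lemma component_qe (x : X) i (y : component_qc x) z :
  qe i (val y) = Some z ->
  exists2 z' : component_qc x, qe i y = Some z' & val z' = z.
Proof.
move=> eyz; have zx : z \in component x.
  by apply: mem_set; apply: reachable_e eyz; exact: set_mem (valP y).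
by exists (exist _ z zx); rewrite //= eyz /= insubT.
Qed.

Lemma component_qf (x : X) i (y : component_qc x) z :
  qf i (val y) = Some z ->
  exists2 z' : component_qc x, qf i y = Some z' & val z' = z.
Proof.
move=> fyz; have zx : z \in component x.
  by apply: mem_set; apply: reachable_f fyz; exact: set_mem (valP y).
by exists (exist _ z zx); rewrite //= fyz /= insubT.
Qed.

Variables (T : Type) (E F : I -> T -> option T).

(** The image of [g] is stable under the operators, which act there through the partial operators
    [E], [F] on parameters. Two maps intertwining the same [E] and [F] are to be compared. *)
Definition intertwines (g : T -> X) :=
  forall i t, qe i (g t) = omap g (E i t) /\ qf i (g t) = omap g (F i t).

(** Each step of a path from [g t] comes from a step of [E] or [F] on the parameter, and [h] replays
    that step. *)
Lemma intertwines_reachable (g h : T -> X) t y :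
  intertwines g -> intertwines h -> reachable (g t) y ->
  exists2 t', y = g t' & reachable (h t) (h t').
Proof.
move=> gEF hEF; elim=> [|i {}y z _ [t' -> ht']|i {}y z _ [t' -> ht']].
- by exists t => //; apply: reachable_refl.
- rewrite (gEF i t').1; case Et': (E i t') => [t''|] //= [<-].
  by exists t'' => //; apply: (reachable_e (i := i) ht'); rewrite (hEF i t').1 Et'.
- rewrite (gEF i t').2; case Ft': (F i t') => [t''|] //= [<-].
  by exists t'' => //; apply: (reachable_f (i := i) ht'); rewrite (hEF i t').2 Ft'.
Qed.

Section Transport.
Variables (g h : T -> X) (g' h' : X -> T).
Hypotheses (gK : cancel g g') (hK : cancel h h').
Hypotheses (gEF : intertwines g) (hEF : intertwines h).
Variable t : T.

Lemma transport_subproof (y : component_qc (g t)) :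
  h (g' (val y)) \in component (h t).
Proof.
apply: mem_set.
have [t' -> ht'] := intertwines_reachable gEF hEF (set_mem (valP y)).
by rewrite gK.
Qed.

Definition transport (y : component_qc (g t)) : component_qc (h t) :=
  exist _ (h (g' (val y))) (transport_subproof y).

End Transport.

(** Both components are images of the orbit of [t] under [E] and [F], and the isomorphism sends
    [g t'] to [h t']. The left inverses recover the parameter, so this map and its inverse are well
    defined. *)
Lemma component_equiv_intertwines (g h : T -> X) (g' h' : X -> T) :
  cancel g g' -> cancel h h' -> intertwines g -> intertwines h ->
  (forall t, wt (g t) = wt (h t)) ->
  (forall i t, qeps i (g t) = qeps i (h t)) ->
  (forall i t, qphi i (g t) = qphi i (h t)) ->
  forall t, component_equiv (g t) (h t).
Proof.
move=> gK hK gEF hEF wtE epsE phiE t.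
have compE (y : component_qc (g t)) : exists t', val y = g t'.
  by have [t' ? _] := intertwines_reachable gEF hEF (set_mem (valP y)); exists t'.
have compE' (y : component_qc (h t)) : exists t', val y = h t'.
  by have [t' ? _] := intertwines_reachable hEF gEF (set_mem (valP y)); exists t'.
pose psi := transport gK gEF hEF (t := t).
have psiE y t' : val y = g t' -> val (psi y) = h t' by move=> /= ->; rewrite gK.
have qe_psi i y z : qe i y = Some z -> qe i (psi y) = Some (psi z).
  have [t' yt'] := compE y.
  case Et': (E i t') => [t''|]; last by rewrite /= yt' (gEF _ _).1 Et'.
  have [|z' -> z't''] := @component_qe _ i y (g t''); first by rewrite yt' (gEF _ _).1 Et'.
  have [|w -> wt''] := @component_qe _ i (psi y) (h t'').
    by rewrite (psiE _ _ yt') (hEF _ _).1 Et'.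
  by case=> <-; congr Some; apply: val_inj; rewrite wt'' (psiE _ _ z't'').
have qf_psi i y z : qf i y = Some z -> qf i (psi y) = Some (psi z).
  have [t' yt'] := compE y.
  case Ft': (F i t') => [t''|]; last by rewrite /= yt' (gEF _ _).2 Ft'.
  have [|z' -> z't''] := @component_qf _ i y (g t''); first by rewrite yt' (gEF _ _).2 Ft'.
  have [|w -> wt''] := @component_qf _ i (psi y) (h t'').
    by rewrite (psiE _ _ yt') (hEF _ _).2 Ft'.
  by case=> <-; congr Some; apply: val_inj; rewrite wt'' (psiE _ _ z't'').
exists psi; split; last by apply: val_inj; rewrite (psiE _ t).
split=> //.
- exists (transport hK hEF gEF (t := t)) => y; apply: val_inj => /=.
    by have [t' ->] := compE y; rewrite gK hK.
  by have [t' ->] := compE' y; rewrite hK gK.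
- by move=> y; have [t' yt'] := compE y; rewrite /= yt' gK wtE.
- by move=> i y; have [t' yt'] := compE y; rewrite /= yt' gK epsE.
- by move=> i y; have [t' yt'] := compE y; rewrite /= yt' gK phiE.
- move=> i y; split; last by case Ey: (qe i y) => [z|] // _; rewrite (qe_psi _ _ _ Ey).
  have [t' yt'] := compE y; case Et': (E i t') => [t''|].
    have [|z' -> //] := @component_qe _ i y (g t''); by rewrite yt' (gEF _ _).1 Et'.
  by rewrite /= yt' gK (hEF _ _).1 Et'.
- move=> i y; split; last by case Fy: (qf i y) => [z|] // _; rewrite (qf_psi _ _ _ Fy).
  have [t' yt'] := compE y; case Ft': (F i t') => [t''|].
    have [|z' -> //] := @component_qf _ i y (g t''); by rewrite yt' (gEF _ _).2 Ft'.
  by rewrite /= yt' gK (hEF _ _).2 Ft'.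
Qed.

End Components.

(** * Factorizations of words, and insertion of a word *)

Lemma split_last (T : Type) (p : pred T) s :
  has p s -> exists s1 x s2, [/\ s = s1 ++ x :: s2, p x & ~~ has p s2].
Proof.
elim: s => //= y s IHs; have [ps _|ps] := boolP (has p s).
  by have [s1 [x [s2 [-> px ps2]]]] := IHs ps; exists (y :: s1), x, s2.
by rewrite orbF => py; exists [::], y, s.
Qed.

Lemma split_first (T : Type) (p : pred T) s :
  has p s -> exists s1 x s2, [/\ s = s1 ++ x :: s2, p x & ~~ has p s1].
Proof.
elim: s => //= y s IHs; have [py _|npy /= ps] := boolP (p y).
  by exists [::], y, s.
have [s1 [x [s2 [-> px ps1]]]] := IHs ps.
by exists (y :: s1), x, s2; rewrite /= (negPf npy).
Qed.

(** The inserted word comes last so that [insert a b] is a parametrization by [w]. *)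
Definition insert (T : Type) (a b w : seq T) := a ++ w ++ b.

Lemma insertK (T : Type) (a b : seq T) :
  cancel (insert a b)
    (fun s => take (size s - (size a + size b)) (drop (size a) s)).
Proof.
move=> w; rewrite drop_size_cat // !size_cat addnCA addnK.
exact: take_size_cat.
Qed.

(** * The positions of the free quasi-crystal and degeneracy *)

Section FreeQuasiCrystal.
Variables (V : nmodType) (I : Type) (Q : qc_data V I).
Implicit Types (i : I) (w a b s t : seq Q).

Lemma apply_at_cat (g : Q -> option Q) s x t :
  apply_at g (size s) (s ++ x :: t) = omap (fun y => s ++ y :: t) (g x).
Proof. by rewrite /apply_at drop_size_cat // take_size_cat. Qed.

Lemma eps_last_cat i s x t :
  eps_pos i x -> ~~ has (eps_pos i) t -> eps_last i (s ++ x :: t) = size s.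
Proof.
move=> px nt; have ltsw : (size s < size (s ++ x :: t))%N.
  by rewrite size_cat /= addnS ltnS leq_addr.
apply/anti_leq/andP; split; last first.
  apply: (@leq_bigmax_cond _ _ _ (Ordinal ltsw)).
  by rewrite (tnth_nth x) /= nth_cat ltnn subnn.
apply/bigmax_leqP => k; rewrite (tnth_nth x) /= leqNgt; apply: contraL => ltsk.
rewrite nth_cat ltnNge (ltnW ltsk) /= -(subnSK ltsk) /=.
apply: contra nt => pk; apply/(has_nthP x); exists (k - (size s).+1)%N => //.
by rewrite ltn_subLR // addSnnS -[(size t).+1]/(size (x :: t)) -size_cat ltn_ord.
Qed.

Lemma phi_first_cat i s x t :
  phi_pos i x -> ~~ has (phi_pos i) s -> phi_first i (s ++ x :: t) = size s.
Proof. by move=> px ns; rewrite /phi_first find_cat (negPf ns) /= px addn0. Qed.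

(** The inequality between positions becomes the existence of a cut with a positive [qphi] on its
    left and a positive [qeps] on its right. Such a cut is easy to follow through an insertion. *)
Lemma degenerateP i w :
  degenerate i w <->
  has (fun x => qeps i x == +oo%E) w \/
  exists n, has (phi_pos i) (take n w) && has (eps_pos i) (drop n w).
Proof.
split=> [/orP[|/and3P[hasE hasP]]|[|[n /andP[hasP hasE]]]].
- by left.
- move: hasE hasP => /split_last[s [x [t [-> px nt]]]] hasP.
  (* The cut is placed just before the last letter with positive [qeps]. *)
  rewrite eps_last_cat // => lt_first; right; exists (size s).
  by rewrite has_take // lt_first drop_size_cat //= px.
- by rewrite /degenerate => ->.
have hasPw : has (phi_pos i) w by rewrite -(cat_take_drop n w) has_cat hasP.
have hasEw : has (eps_pos i) w by rewrite -(cat_take_drop n w) has_cat hasE orbT.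
apply/orP; right; rewrite hasPw hasEw /=.
have lt_first : (phi_first i w < n)%N by rewrite -has_take.
apply: leq_trans lt_first _.
have [s [x [t [def_w px nt]]]] := split_last hasEw.
(* A cut strictly after position [size s] would leave on its right only letters of [t], none of
   which has positive [qeps]. *)
rewrite {1}def_w eps_last_cat // leqNgt; apply: contraL hasE => ltsn.
rewrite def_w drop_cat ltnNge (ltnW ltsn) /= -(subnSK ltsn) /=.
apply: contra nt => hasE.
by rewrite -(cat_take_drop (n - (size s).+1) t) has_cat hasE orbT.
Qed.

(** An infinite letter survives insertion. A cut inside [a] or at its end stays in place, and a
    later one moves right by [size w]. *)
Lemma degenerate_insert i a b w :
  degenerate i (a ++ b) -> degenerate i (insert a b w).
Proof.
move=> /degenerateP[inf|[n /andP[hasP hasE]]]; apply/degenerateP.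
  by left; move: inf; rewrite !has_cat => /orP[] ->; rewrite ?orbT.
right; have [lena|ltan] := leqP n (size a).
  exists n; move: hasP hasE; rewrite !(take_cat _ a) !(drop_cat _ a).
  (* The boundary cut [n = size a] is separate because [take_cat] and [drop_cat] test
     [n < size a]. *)
  move: lena; rewrite leq_eqVlt => /predU1P[->|->] /=.
    by rewrite ltnn subnn !take0 !drop0 !cats0 has_cat => -> ->; rewrite orbT.
  by move=> ->; rewrite !has_cat => /orP[] ->; rewrite ?orbT.
exists (n + size w)%N; rewrite /insert.
move: hasP hasE; rewrite !take_cat !drop_cat.
rewrite !ltnNge (ltnW ltan) (leq_trans (ltnW ltan) (leq_addr _ _)) /=.
rewrite -addnBAC ?(ltnW ltan) // leq_addl /= addnK !has_cat.
by move=> /orP[] -> ->; rewrite ?orbT.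
Qed.

(** * Letters invisible to the [i]-structure, and insertion between them *)

Definition trivial_letter i (x : Q) := (qeps i x == 0%E) && (qphi i x == 0%E).

Lemma trivial_eps_infty i s :
  all (trivial_letter i) s -> has (fun x => qeps i x == +oo%E) s = false.
Proof. by elim: s => //= x s IHs /andP[/andP[/eqP-> _] /IHs]. Qed.

Lemma trivial_eps_pos i s :
  all (trivial_letter i) s -> has (eps_pos i) s = false.
Proof.
by elim: s => //= x s IHs /andP[/andP[/eqP x0 _] /IHs->]; rewrite /eps_pos x0 ltxx.
Qed.

Lemma trivial_phi_pos i s :
  all (trivial_letter i) s -> has (phi_pos i) s = false.
Proof.
by elim: s => //= x s IHs /andP[/andP[_ /eqP x0] /IHs->]; rewrite /phi_pos x0 ltxx.
Qed.

Lemma trivial_sum_eps i s :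
  all (trivial_letter i) s -> (\sum_(x <- s) qeps i x)%E = 0%E.
Proof.
elim: s => [|x s IHs] /=; first by rewrite big_nil.
by case/andP => /andP[/eqP x0 _] /IHs s0; rewrite big_cons x0 s0 adde0.
Qed.

Lemma trivial_sum_phi i s :
  all (trivial_letter i) s -> (\sum_(x <- s) qphi i x)%E = 0%E.
Proof.
elim: s => [|x s IHs] /=; first by rewrite big_nil.
by case/andP => /andP[_ /eqP x0] /IHs s0; rewrite big_cons x0 s0 adde0.
Qed.

Section TrivialInsert.
Variables (i : I) (a b w : seq Q).
Hypotheses (ta : all (trivial_letter i) a) (tb : all (trivial_letter i) b).

Lemma has_eps_pos_insert :
  has (eps_pos i) (insert a b w) = has (eps_pos i) w.
Proof. by rewrite !has_cat (trivial_eps_pos ta) (trivial_eps_pos tb) orbF. Qed.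

Lemma has_phi_pos_insert :
  has (phi_pos i) (insert a b w) = has (phi_pos i) w.
Proof. by rewrite !has_cat (trivial_phi_pos ta) (trivial_phi_pos tb) orbF. Qed.

(** The last positive letter lies in [w], and only the prefix [a] shifts it. If [w] had no such
    letter, [eps_last] would be 0 on both words and the shift could fail. *)
Lemma eps_last_insert :
  has (eps_pos i) w -> eps_last i (insert a b w) = (size a + eps_last i w)%N.
Proof.
move=> /split_last[s [x [t [-> px nt]]]].
have -> : insert a b (s ++ x :: t) = (a ++ s) ++ x :: (t ++ b).
  by rewrite /insert -!catA.
by rewrite !eps_last_cat ?size_cat // has_cat (negPf nt) trivial_eps_pos.
Qed.

Lemma phi_first_insert :
  has (phi_pos i) w -> phi_first i (insert a b w) = (size a + phi_first i w)%N.
Proof. by move=> pw; rewrite /phi_first !find_cat pw trivial_phi_pos. Qed.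

Lemma degenerate_trivial_insert :
  degenerate i (insert a b w) = degenerate i w.
Proof.
rewrite /degenerate has_eps_pos_insert has_phi_pos_insert.
rewrite {1}/insert !has_cat (trivial_eps_infty ta) (trivial_eps_infty tb) orbF.
case hasE: (has (eps_pos i) w) => //; case hasP: (has (phi_pos i) w) => //=.
by rewrite eps_last_insert // phi_first_insert // ltn_add2l.
Qed.

Lemma qe_trivial_insert :
  qe (q := free_qc Q) i (insert a b w)
  = omap (insert a b) (qe (q := free_qc Q) i w).
Proof.
rewrite /= degenerate_trivial_insert has_eps_pos_insert.
case: ifP => // /andP[_ /split_last[s [x [t [-> px nt]]]]].
have -> : insert a b (s ++ x :: t) = (a ++ s) ++ x :: (t ++ b).
  by rewrite /insert -!catA.
rewrite !eps_last_cat ?has_cat ?(negPf nt) ?trivial_eps_pos //.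
by rewrite !apply_at_cat; case: (qe i x) => //= y; rewrite /insert -!catA.
Qed.

Lemma qf_trivial_insert :
  qf (q := free_qc Q) i (insert a b w)
  = omap (insert a b) (qf (q := free_qc Q) i w).
Proof.
rewrite /= degenerate_trivial_insert has_phi_pos_insert.
case: ifP => // /andP[_ /split_first[s [x [t [-> px ns]]]]].
have -> : insert a b (s ++ x :: t) = (a ++ s) ++ x :: (t ++ b).
  by rewrite /insert -!catA.
rewrite !phi_first_cat ?has_cat ?(negPf ns) ?trivial_phi_pos //.
by rewrite !apply_at_cat; case: (qf i x) => //= y; rewrite /insert -!catA.
Qed.

Lemma qeps_trivial_insert :
  qeps (q := free_qc Q) i (insert a b w) = qeps (q := free_qc Q) i w.
Proof.
rewrite /= degenerate_trivial_insert /insert !big_cat /=.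
by rewrite !(trivial_sum_eps ta, trivial_sum_eps tb) add0e adde0.
Qed.

Lemma qphi_trivial_insert :
  qphi (q := free_qc Q) i (insert a b w) = qphi (q := free_qc Q) i w.
Proof.
rewrite /= degenerate_trivial_insert /insert !big_cat /=.
by rewrite !(trivial_sum_phi ta, trivial_sum_phi tb) add0e adde0.
Qed.

End TrivialInsert.

(** The dichotomy concerns only the product [a ++ b], not where it is cut. Hence [insert a b] and
    [insert c d] intertwine the same operators on the inserted word. *)
Lemma insert_equiv a b c d :
  a ++ b = c ++ d ->
  (forall i, degenerate i (a ++ b) \/ all (trivial_letter i) (a ++ b)) ->
  forall w, hypoplactic (insert a b w) (insert c d w).
Proof.
move=> abcd iso_ab.
(* For degenerate [i] every insertion is degenerate and the operators are undefined; for the other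
   [i] they act on [w] alone. *)
pose E i w := if degenerate i (a ++ b) then None else qe (q := free_qc Q) i w.
pose F i w := if degenerate i (a ++ b) then None else qf (q := free_qc Q) i w.
have twine a' b' : a' ++ b' = a ++ b ->
    intertwines (X := free_qc Q) E F (insert a' b').
  move=> ab' i w; rewrite /E /F; case: ifPn => [deg|ndeg].
    by rewrite /= (@degenerate_insert i a' b') // ab'.
  case: (iso_ab i) => [|]; first by rewrite (negPf ndeg).
  rewrite -ab' all_cat => /andP[ta tb].
  by rewrite qe_trivial_insert // qf_trivial_insert.
apply: (component_equiv_intertwines (X := free_qc Q) (@insertK Q a b)
  (@insertK Q c d) (twine _ _ erefl) (twine _ _ (esym abcd))).
- move=> w /=; have -> : (\sum_(x <- insert a b w) wt x =
      \sum_(x <- w) wt x + \sum_(x <- a ++ b) wt x)%R.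
    by rewrite /insert !big_cat /= addrCA.
  by rewrite abcd /insert !big_cat /= addrCA.
- move=> i w; case: (iso_ab i) => [deg|].
    by rewrite /= !degenerate_insert // -abcd.
  move=> tab; move: (tab); rewrite abcd all_cat => /andP[tc td].
  move: tab; rewrite all_cat => /andP[ta tb].
  by rewrite !qeps_trivial_insert.
- move=> i w; case: (iso_ab i) => [deg|].
    by rewrite /= !degenerate_insert // -abcd.
  move=> tab; move: (tab); rewrite abcd all_cat => /andP[tc td].
  move: tab; rewrite all_cat => /andP[ta tb].
  by rewrite !qphi_trivial_insert.
Qed.

End FreeQuasiCrystal.

(** * Isolated words under seminormality *)

Lemma iter_obind_isSome (T : Type) (f : T -> option T) n x :
  isSome (iter n.+1 (obind f) (Some x)) -> isSome (f x).
Proof.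
rewrite iterSr /=; case: (f x) => //.
by have -> : iter n (obind f) None = None by elim: n => //= n ->.
Qed.

Lemma is_max_obind_eq0 (T : Type) (f : T -> option T) x z :
  is_max (fun k => isSome (iter k (obind f) (Some x))) z ->
  ~~ isSome (f x) -> z = 0%E.
Proof.
case=> n [-> + _]; case: n => // n fnx.
by rewrite (iter_obind_isSome fnx).
Qed.

Section Isolated.
Variables (R : realType) (V : vectType R) (dot : {dot V for idfun}).
Variables (I : finType) (alpha : I -> V) (Lambda : set V) (Q : qc_data V I).
Hypotheses (alpha_neq0 : forall i, alpha i != 0)
  (hQ : is_quasi_crystal dot alpha Lambda Q) (hsemi : seminormal Q).

(** A defined value would have to be [z] itself, so the modified letter would be fixed by [qe i],
    although its weight changes by [alpha i], which is nonzero. *)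
Lemma isolated_qe (z : seq Q) i :
  isolated (X := free_qc Q) z -> qe (q := free_qc Q) i z = None.
Proof.
move=> iso_z; case ez: (qe (q := free_qc Q) i z) => [z'|] //.
have : component (X := free_qc Q) z z'.
  exact: reachable_e (reachable_refl _) ez.
rewrite iso_z => /= z'z; move: ez; rewrite /= {}z'z.
case: ifP => // /andP[_ /split_last[s [x [t [-> px nt]]]]].
rewrite eps_last_cat // apply_at_cat; case ex: (qe i x) => [y|] //= [].
(* Removing the common prefix [s] identifies the new letter [y] with the old letter [x]. *)
move=> /(congr1 (drop (size s))); rewrite !drop_size_cat // => -[yx].
have [/eqP + _ _] := qc_e hQ ex.
by rewrite yx -subr_eq0 opprD addNKr oppr_eq0 (negPf (alpha_neq0 i)).
Qed.

Lemma isolated_qf (z : seq Q) i :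
  isolated (X := free_qc Q) z -> qf (q := free_qc Q) i z = None.
Proof.
move=> iso_z; case fz: (qf (q := free_qc Q) i z) => [z'|] //.
have : component (X := free_qc Q) z z'.
  exact: reachable_f (reachable_refl _) fz.
rewrite iso_z => /= z'z; move: fz; rewrite /= {}z'z.
case: ifP => // /andP[_ /split_first[s [x [t [-> px ns]]]]].
rewrite phi_first_cat // apply_at_cat; case fx: (qf i x) => [y|] //= [].
move=> /(congr1 (drop (size s))); rewrite !drop_size_cat // => -[yx].
have [/eqP + _ _] := qc_f hQ fx.
by rewrite yx -subr_eq0 opprB addrCA subrr addr0 (negPf (alpha_neq0 i)).
Qed.

(** In a nondegenerate word a letter with positive [qeps] or [qphi] would, by seminormality, make an
    operator defined on the word, against isolation. *)
Lemma isolated_trivial (z : seq Q) i :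
  isolated (X := free_qc Q) z -> degenerate i z \/ all (trivial_letter i) z.
Proof.
move=> iso_z; have [deg|ndeg] := boolP (degenerate i z); [by left|right].
have fin : ~~ has (fun x => qeps i x == +oo%E) z.
  by apply: contra ndeg; rewrite /degenerate => ->.
have no_eps : ~~ has (eps_pos i) z.
  apply/negP => hasE; have := isolated_qe i iso_z; rewrite /= ndeg hasE /=.
  have [s [x [t [def_z px nt]]]] := split_last hasE.
  move: fin; rewrite def_z eps_last_cat // apply_at_cat has_cat /= !negb_or.
  case/and3P=> _ /eqP xfin _; case ex: (qe i x) => [y|] // _.
  have [maxe _] := hsemi xfin.
  by move: px; rewrite /eps_pos (is_max_obind_eq0 maxe) ?ex // ltxx.
have no_phi : ~~ has (phi_pos i) z.
  apply/negP => hasP; have := isolated_qf i iso_z; rewrite /= ndeg hasP /=.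
  have [s [x [t [def_z px ns]]]] := split_first hasP.
  move: fin; rewrite def_z phi_first_cat // apply_at_cat has_cat /= !negb_or.
  case/and3P=> _ /eqP xfin _; case fx: (qf i x) => [y|] // _.
  have [_ maxf] := hsemi xfin.
  by move: px; rewrite /phi_pos (is_max_obind_eq0 maxf) ?fx // ltxx.
(* The three letterwise facts pass to the tail, so the induction carries these in place of isolation
   and nondegeneracy. *)
elim: z fin no_eps no_phi {iso_z ndeg} => //= x z IHz.
rewrite !negb_or => /andP[/eqP xfin zfin] /andP[xe ze] /andP[xp zp].
rewrite IHz // andbT /trivial_letter.
have [[m [em _ _]] [n [en _ _]]] := hsemi xfin.
(* Seminormality makes both values natural numbers; not being positive, they vanish. *)
by move: xe xp; rewrite /eps_pos /phi_pos em en; case: m {em}; case: n {en}.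
Qed.

End Isolated.

Theorem theorem7p5 (R : realType) (V : vectType R) (dot : {dot V for idfun})
    (Phi : set V) (I : finType) (alpha : I -> V) (Lambda : set V)
    (Q : qc_data V I)
    (hPhi : is_root_system dot Phi)
    (halpha : is_simple_system Phi alpha)
    (hLambda : is_weight_lattice dot Phi Lambda)
    (hQ : is_quasi_crystal dot alpha Lambda Q)
    (hsemi : seminormal Q)
    (u v : seq Q)
    (huv : isolated (X := free_qc Q) (u ++ v)) :
  forall w : seq Q,
    hypoplactic (u ++ v ++ w) (u ++ w ++ v) /\
    hypoplactic (u ++ w ++ v) (w ++ u ++ v).
Proof.
have alpha_neq0 i : alpha i != 0.
  exact: (root_neq0 hPhi (simple_root halpha i)).
move=> w; have iso_uv i := isolated_trivial alpha_neq0 hQ hsemi i huv.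
(* The three words insert [w] at the three cuts of [u ++ v]: after [v], between [u] and [v], and
   before [u]. *)
split; last exact: (@insert_equiv _ _ _ u v [::] (u ++ v)).
have := @insert_equiv _ _ _ (u ++ v) [::] u v; rewrite cats0.
by move=> /(_ erefl iso_uv w); rewrite /insert cats0 -catA.
Qed.
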